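(* Addition is not first-order definable in the structure $\langle\mathbb{Q},\cdot,\leqslant\rangle$; that is, there is no first-order formula $\varphi(x,y,z)$ in the language $\{\cdot,\leqslant\}$ such that for all $x,y,z\in\mathbb{Q}$, $x+y=z$ if and only if $\varphi(x,y,z)$ holds in $\langle\mathbb{Q},\cdot,\leqslant\rangle$.
   Context: $\langle\mathbb{Q},\cdot,\leqslant\rangle$ is the first-order structure whose domain is the set of all rational numbers, with the usual multiplication and the usual (non-strict) order. Definability is meant without parameters. *)

(* Defs.v *)
From mathcomp Require Import all_boot all_order all_algebra.
Set Implicit Arguments.
Unset Strict Implicit.
Unset Printing Implicit Defensive.

(* First-order logic with equality over the language {mul, le}, with variables
   named by natural numbers. There is no constant symbol, so that formulas are
   parameter-free. *)
Inductive term : Type :=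
  | Var of nat
  | Mul of term & term.

Inductive formula : Type :=
  | Bot
  | Eq of term & term
  | Le of term & term
  | Not of formula
  | And of formula & formula
  | Or of formula & formula
  | Imp of formula & formula
  | Forall of nat & formula
  | Exists of nat & formula.

Fixpoint term_vars (t : term) : seq nat :=
  match t with
  | Var i => [:: i]
  | Mul t1 t2 => term_vars t1 ++ term_vars t2
  end.

Fixpoint free_vars (p : formula) : seq nat :=
  match p with
  | Bot => [::]
  | Eq t1 t2 | Le t1 t2 => term_vars t1 ++ term_vars t2
  | Not q => free_vars q
  | And q r | Or q r | Imp q r => free_vars q ++ free_vars r
  | Forall i q | Exists i q => [seq j <- free_vars q | j != i]
  end.

Record structure : Type := Structure {
  dom :> Type;
  mul_op : dom -> dom -> dom;
  le_rel : dom -> dom -> Prop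
}.

Fixpoint eval (M : structure) (v : nat -> M) (t : term) : M :=
  match t with
  | Var i => v i
  | Mul t1 t2 => mul_op (eval v t1) (eval v t2)
  end.

Fixpoint sat (M : structure) (v : nat -> M) (p : formula) : Prop :=
  match p with
  | Bot => False
  | Eq t1 t2 => eval v t1 = eval v t2
  | Le t1 t2 => le_rel (eval v t1) (eval v t2)
  | Not q => ~ sat v q
  | And q r => sat v q /\ sat v r
  | Or q r => sat v q \/ sat v r
  | Imp q r => sat v q -> sat v r
  | Forall i q => forall a : M, sat [eta v with i |-> a] q
  | Exists i q => exists a : M, sat [eta v with i |-> a] q
  end.

Definition rat_mul_le : structure :=
  @Structure rat (fun x y => (x * y)%R) (fun x y => (x <= y)%R).

(* x, y, z are assigned to the variables 0, 1, 2. The value of the other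
   variables is a dummy: it is irrelevant to a formula whose free variables are
   among 0, 1, 2. *)
Definition assign3 (x y z : rat) : nat -> rat_mul_le :=
  fun i => nth (0%R : rat) [:: x; y; z] i.

(* Main.v *)
Require Import Defs.
From mathcomp Require Import all_boot all_order all_algebra.
From mathcomp Require Import zify ring lra.
Set Implicit Arguments.
Unset Strict Implicit.
Unset Printing Implicit Defensive.
Import Order.TTheory GRing.Theory Num.Theory.
Local Open Scope ring_scope.

(* If addition were definable, then 2 would be too, as the z with 1 + 1 = z. But
   each formula fails to distinguish 2 from 2^(M+1) for some M > 0, by a
   back-and-forth argument in the ordered multiplicative group G of positive
   rationals. Call tuples v, w in G similar at level (N, M) when w_i / v_i is an
   M-th power in G for all i and the monomials with exponents in [-N, N] compare
   with 1 in the same way at v and at w. If v, w are similar at level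
   (2N^2, M N!), then any g in G has a partner h such that (v, g), (w, h) are
   similar at level (N, M): either g^e is a monomial in v for some 0 < e <= N,
   and then h is the e-th root of the same monomial in w, which exists because
   the quotient of the two monomials is an (M N!)-th power; or h has to satisfy
   finitely many strict inequalities, which are compatible, and h = g t^M solves
   them because the n-th powers are dense in G for every n > 0. *)

(** * Density of n-th powers in the positive rationals *)

Lemma bernoulli_le (x : rat) (n : nat) : -1 <= x -> 1 + n%:R * x <= (1 + x) ^+ n.
Proof.
move=> hx; elim: n => [|n IHn]; first by rewrite expr0 mul0r addr0.
rewrite exprS; apply: le_trans (ler_wpM2l _ IHn); last by lra.
rewrite -natr1; have := sqr_ge0 x; have : (0 : rat) <= n%:R by [].
by rewrite expr2; nra.
Qed.

Lemma exists_expr_lt (q e : rat) : 0 < q < 1 -> 0 < e -> exists n : nat, q ^+ n < e.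
Proof.
case/andP=> q0 q1 e0; pose y := q^-1 - 1.
have y0 : 0 < y by rewrite subr_gt0 invf_gt1.
exists (Num.bound (e^-1 / y)).
have hb : e^-1 / y < (Num.bound (e^-1 / y))%:R.
  by apply: archi_boundP; rewrite divr_ge0 // ?invr_ge0 ltW.
rewrite -[ltRHS]invrK -[ltLHS]invrK ltf_pV2 ?posrE ?invr_gt0 ?exprn_gt0 //.
rewrite -exprVn (_ : q^-1 = 1 + y); last by rewrite /y; ring.
apply: lt_le_trans (bernoulli_le _ _); last by lra.
by rewrite ltr_pdivrMr // in hb; lra.
Qed.

(** The geometric sequence [(1 + b) * q ^+ j] starts with an n-th power at least [b], and its ratio
    satisfies [a / b < q ^+ n]. So the first term whose n-th power drops below [b] cannot also jump
    below [a]. *)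
Lemma exprn_between (n : nat) (a b : rat) : (0 < n)%N -> 0 <= a < b ->
  exists2 t : rat, 0 < t & a < t ^+ n < b.
Proof.
move=> n0 /andP[a0 ab]; have b0 : 0 < b by apply: le_lt_trans ab.
(* Bernoulli gives [(1 - x) ^+ n >= 1 - n x]; dividing by [n.+1] instead of [n] keeps this strictly
   above [a / b]. *)
pose x := (1 - a / b) / (n.+1)%:R.
have ab1 : a / b < 1 by rewrite ltr_pdivrMr // mul1r.
have ab0 : 0 <= a / b by rewrite divr_ge0 // ltW.
have n1 : (0 : rat) < n.+1%:R by [].
have xE : x * n.+1%:R = 1 - a / b by rewrite /x mulfVK ?gt_eqF.
have x0 : 0 < x by rewrite divr_gt0 // subr_gt0.
have xn : n%:R * x < 1 - a / b by rewrite -xE -natr1; nra.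
have n1' : (1 : rat) <= n%:R by rewrite ler1n.
have x1 : x < 1 by nra.
pose q := 1 - x.
have q0 : 0 < q by rewrite subr_gt0.
have q1 : q < 1 by rewrite /q; lra.
have qn : a / b < q ^+ n.
  apply: lt_le_trans (bernoulli_le _ _); last by lra.
  by rewrite mulrN; lra.
have sb : b <= (1 + b) ^+ n.
  apply: le_trans (bernoulli_le _ _); last by lra.
  by nra.
have s0 : 0 < 1 + b by lra.
have ex : exists j, ((1 + b) * q ^+ j) ^+ n < b.
  have qn01 : 0 < q ^+ n < 1 by rewrite exprn_gt0 // exprn_ilt1 ?ltW // -lt0n.
  have bs0 : 0 < b / (1 + b) ^+ n by rewrite divr_gt0 // exprn_gt0.
  have [j hj] := exists_expr_lt qn01 bs0.
  by exists j; rewrite exprMn exprAC mulrC -ltr_pdivlMr ?exprn_gt0.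
case: (ex_minnP ex) => j hj jmin.
exists ((1 + b) * q ^+ j); first by rewrite mulr_gt0 ?exprn_gt0.
rewrite hj andbT; case: j hj jmin => [|j] hj jmin.
  by rewrite mulr1 ltNge sb in hj.
have : b <= ((1 + b) * q ^+ j) ^+ n.
  by rewrite leNgt; apply/negP=> /jmin; rewrite ltnn.
move=> hbj; rewrite exprSr mulrA exprMn.
rewrite ltr_pdivrMr // in qn.
apply: lt_le_trans qn _.
by rewrite mulrC ler_wpM2r // exprn_ge0 // ltW.
Qed.

Lemma exprn_between_seq (n : nat) (A B : seq rat) : (0 < n)%N ->
  {in B, forall b, 0 < b} -> {in A & B, forall a b, a < b} ->
  exists t : rat, [/\ 0 < t, {in A, forall a, a < t ^+ n} & {in B, forall b, t ^+ n < b}].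
Proof.
move=> n0 B0 AB.
(* One interval suffices: [a0] is the maximum of 0 and [A], and [b0] is a lower bound of [B] above
   [a0], started at [a0 + 1] in case [B] is empty. *)
have [a0 [a0_ge0 Aa0 a0B]] : exists a0 : rat,
    [/\ 0 <= a0, {in A, forall a, a <= a0} & {in B, forall b, a0 < b}].
  elim: A AB => [|a A IHA] AB; first by exists 0.
  have [|a0 [a0_ge0 Aa0 a0B]] := IHA.
    by move=> x y xA; apply: AB; rewrite inE xA orbT.
  exists (Num.max a a0); split=> [|x|b bB].
  - by rewrite le_max a0_ge0 orbT.
  - by rewrite inE le_max => /predU1P[->|/Aa0->]; rewrite ?lexx ?orbT.
  - by rewrite gt_max a0B // AB // mem_head.
have [b0 [ab0 b0B]] : exists b0 : rat, a0 < b0 /\ {in B, forall b, b0 <= b}.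
  elim: B a0B {B0 AB} => [|b B IHB] a0B; first by exists (a0 + 1); rewrite ltrDl.
  have [|b0 [ab0 b0B]] := IHB; first by move=> x xB; apply: a0B; rewrite inE xB orbT.
  exists (Num.min b b0); split=> [|x]; first by rewrite lt_min ab0 a0B // mem_head.
  by rewrite inE ge_min => /predU1P[->|/b0B->]; rewrite ?lexx ?orbT.
have [|t t0 /andP[at_ tb]] := @exprn_between n a0 b0 n0; first by rewrite a0_ge0.
exists t; split=> // [a /Aa0 h|b /b0B h]; first exact: le_lt_trans at_.
exact: lt_le_trans h.
Qed.

(** * Monomials over the positive rationals and the extension of similar tuples *)

Section Monomials.

Variable k : nat.
Implicit Types (v w : 'I_k -> rat) (m : {ffun 'I_k -> int}) (N M : nat).

Definition monom v m : rat := \prod_i v i ^ m i.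

Definition positive v := forall i, 0 < v i.

Definition bounded N m := forall i, (absz (m i) <= N)%N.

Definition congr_pow M (x y : rat) := exists2 t : rat, 0 < t & y = x * t ^+ M.

Definition similar N M v w :=
  (forall i, congr_pow M (v i) (w i)) /\
  (forall m, bounded N m -> (monom v m <= 1) = (monom w m <= 1)).

Lemma monom_gt0 v m : positive v -> 0 < monom v m.
Proof. by move=> v0; apply: prodr_gt0 => i _; apply: exprz_gt0. Qed.

Lemma eq_monom v w m : v =1 w -> monom v m = monom w m.
Proof. by move=> vw; apply: eq_bigr => i _; rewrite vw. Qed.

Lemma monom0 v : monom v 0 = 1.
Proof. by rewrite /monom big1 // => i _; rewrite ffunE. Qed.

Lemma monomD v m1 m2 : positive v -> monom v (m1 + m2) = monom v m1 * monom v m2.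
Proof.
by move=> v0; rewrite -big_split /=; apply: eq_bigr => i _; rewrite ffunE expfzDr ?gt_eqF.
Qed.

Lemma monomN v m : positive v -> monom v (- m) = (monom v m)^-1.
Proof.
move=> v0; apply: (mulIf (lt0r_neq0 (monom_gt0 m v0))).
by rewrite -monomD // addNr monom0 mulVf ?lt0r_neq0 ?monom_gt0.
Qed.

Lemma monomMn v m (e : nat) : positive v -> monom v (m *+ e) = monom v m ^+ e.
Proof.
by move=> v0; elim: e => [|e IHe]; rewrite ?monom0 // mulrS monomD // IHe exprS.
Qed.

Lemma monom_single v m (i : 'I_k) : (forall j, j != i -> v j = 1) ->
  monom v m = v i ^ m i.
Proof.
by move=> h; rewrite /monom (bigD1 i) //= big1 ?mulr1 // => j ji; rewrite h // exp1rz.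
Qed.

Lemma bounded_enum N :
  exists s : seq {ffun 'I_k -> int}, forall m, m \in s <-> bounded N m.
Proof.
pose dec (f : {ffun 'I_k -> 'I_(N.*2.+1)}) : {ffun 'I_k -> int} :=
  [ffun i => (f i)%:Z - N%:Z].
exists [seq dec f | f : {ffun 'I_k -> 'I_(N.*2.+1)}] => m.
split=> [/imageP[f _ ->] i|hm].
  by rewrite ffunE; case: (f i) => x /= hx; lia.
apply/imageP; exists [ffun i => inord (absz (m i + N%:Z))] => //.
by apply/ffunP => i; rewrite !ffunE inordK; move: (m i) (hm i) => z hz; lia.
Qed.

Lemma congr_pow_refl M x : congr_pow M x x.
Proof. by exists 1; rewrite // expr1n mulr1. Qed.

Lemma congr_pow_sym M x y : congr_pow M x y -> congr_pow M y x.
Proof.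
case=> t t0 ->; exists t^-1; rewrite ?invr_gt0 // -mulrA -exprMn mulfV ?gt_eqF //.
by rewrite expr1n mulr1.
Qed.

Lemma congr_powM M x y x' y' :
  congr_pow M x y -> congr_pow M x' y' -> congr_pow M (x * x') (y * y').
Proof.
move=> [t t0 ->] [u u0 ->]; exists (t * u); first exact: mulr_gt0.
by rewrite exprMn mulrACA.
Qed.

Lemma congr_powXz M x y (e : int) : congr_pow M x y -> congr_pow M (x ^ e) (y ^ e).
Proof.
move=> [t t0 ->]; exists (t ^ e); first exact: exprz_gt0.
rewrite expfzMl; congr (_ * _); exact: (exprzAC t (Posz M) e).
Qed.

Lemma congr_pow_dvd M M' x y : (M %| M')%N -> congr_pow M' x y -> congr_pow M x y.
Proof.
by move=> /dvdnP[d ->] [t t0 ->]; exists (t ^+ d); rewrite ?exprn_gt0 // -exprM.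
Qed.

Lemma congr_pow_monom M v w m :
  (forall i, congr_pow M (v i) (w i)) -> congr_pow M (monom v m) (monom w m).
Proof.
move=> vw; apply: big_ind2 => [|x y x' y'|i _]; first exact: congr_pow_refl.
  exact: congr_powM.
exact: congr_powXz.
Qed.

Lemma similar_sym N M v w : similar N M v w -> similar N M w v.
Proof. by case=> vw h; split=> [i|m /h//]; apply: congr_pow_sym. Qed.

Lemma similar_weaken N N' M M' v w : (N <= N')%N -> (M %| M')%N ->
  similar N' M' v w -> similar N M v w.
Proof.
move=> NN' MM' [vw h]; split=> [i|m mN]; first exact: congr_pow_dvd (vw i).
by apply: h => i; apply: leq_trans NN'.
Qed.

(** The comparison amounts to comparing with 1 the monomial of exponent [m1 *+ e1 - m2 *+ e2], whose
    entries are at most 2N^2 in absolute value. This is the source of the level 2N^2. *)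
Lemma similar_monom_le N M v w m1 m2 (e1 e2 : nat) :
  positive v -> positive w -> similar (2 * N * N) M v w ->
  bounded N m1 -> bounded N m2 -> (e1 <= N)%N -> (e2 <= N)%N ->
  (monom v m1 ^+ e1 <= monom v m2 ^+ e2) = (monom w m1 ^+ e1 <= monom w m2 ^+ e2).
Proof.
move=> v0 w0 [_ h] b1 b2 le1 le2.
have E u : positive u -> (monom u m1 ^+ e1 <= monom u m2 ^+ e2)
    = (monom u (m1 *+ e1 - m2 *+ e2) <= 1).
  by move=> u0; rewrite monomD // monomN // !monomMn // ler_pdivrMr ?mul1r ?exprn_gt0 ?monom_gt0.
rewrite !E //; apply: h => i; rewrite !ffunE.
have A m (e : nat) : bounded N m -> (e <= N)%N -> (absz (m i *+ e) <= N * N)%N.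
  by move=> b le; rewrite -mulr_natr natz abszM leq_mul.
rewrite !ffunMnE; move: (A _ _ b1 le1) (A _ _ b2 le2).
move: (m1 i *+ e1) (m2 i *+ e2) => x y hx hy; rewrite -mulnA.
by move: (N * N)%N hx hy => n; lia.
Qed.

Lemma similar_extend N M v w (g : rat) : (0 < N)%N -> (0 < M)%N ->
  positive v -> positive w -> similar (2 * N * N) (M * N`!) v w -> 0 < g ->
  exists h : rat, [/\ 0 < h, congr_pow M g h &
    forall (e : nat) m, (0 < e <= N)%N -> bounded N m ->
      (g ^+ e <= monom v m) = (h ^+ e <= monom w m) /\
      (monom v m <= g ^+ e) = (monom w m <= h ^+ e)].
Proof.
move=> N0 M0 v0 w0 vw g0.
have [s sP] := bounded_enum N.
pose T := [seq (e, m) | e <- iota 1 N, m <- s].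
have TP (e : nat) m : ((e, m) \in T) = (0 < e <= N)%N && (m \in s).
  apply/allpairsP/andP => [[[e' m'] [/= eN ms [-> ->]]]|[eN ms]].
    by rewrite mem_iota add1n ltnS in eN.
  by exists (e, m); rewrite mem_iota add1n ltnS.
have [/hasP[[e m]]|/hasPn noeq] :=
    boolP (has (fun c : nat * _ => g ^+ c.1 == monom v c.2) T).
  rewrite TP => /andP[/andP[e0 eN] /sP mN] /eqP/= ge.
  have [t t0 wE] := congr_pow_monom m vw.1.
  have eL : (e %| N`!)%N by rewrite dvdn_fact ?e0.
  pose h := g * (t ^+ (N`! %/ e)) ^+ M.
  have h0 : 0 < h by rewrite mulr_gt0 ?exprn_gt0.
  have he : h ^+ e = monom w m.
    by rewrite exprMn ge wE -!exprM mulnAC divnK // mulnC.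
  exists h; split=> // [|e' m' /andP[e'0 e'N] m'N]; first by exists (t ^+ (N`! %/ e)); rewrite ?exprn_gt0.
  (* Raising to the power [e] turns [g ^+ e'] and [h ^+ e'] into powers of the monomial [m], so only
     monomials are left to compare. *)
  have E (x y : rat) : 0 < x -> 0 < y -> (x <= y) = (x ^+ e <= y ^+ e).
    by move=> x0 y0; rewrite ler_pXn2r // nnegrE ltW.
  have gh : forall n : nat, 0 < g ^+ n /\ 0 < h ^+ n by move=> n; rewrite !exprn_gt0.
  have [gp hp] := gh e'.
  split; rewrite E ?monom_gt0 // exprAC ge [in RHS]E ?monom_gt0 // [in RHS]exprAC he;
    exact: (similar_monom_le v0 w0 vw).
pose L := N`!.
have L0 : (0 < L)%N by apply: fact_gt0.
(* For h = g t^M, comparing h^e with monom w m amounts to comparing t^(M L) with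
   f (e, m). *)
pose f (c : nat * {ffun 'I_k -> int}) := monom w c.2 ^+ (L %/ c.1) / g ^+ L.
pose A := [seq f c | c <- T & monom v c.2 < g ^+ c.1].
pose B := [seq f c | c <- T & g ^+ c.1 < monom v c.2].
have gL : 0 < g ^+ L by rewrite exprn_gt0.
have fE (c : nat * {ffun 'I_k -> int}) : (0 < c.1 <= N)%N ->
    (f c * g ^+ L) ^+ c.1 = monom w c.2 ^+ L.
  by move=> c1; rewrite /f divfK ?gt_eqF // -exprM divnK // dvdn_fact.
have f0 c : 0 < f c by rewrite divr_gt0 // exprn_gt0 // monom_gt0.
have fg0 c : 0 <= f c * g ^+ L by rewrite mulr_ge0 // ltW.
have ML0 : (0 < M * L)%N by rewrite muln_gt0 M0.
have B0 : {in B, forall b, 0 < b} by move=> _ /mapP[c _ ->].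
(* After multiplication by [g ^+ L] and raising to the power [e1 * e2], the claim is about monomials
   in [w]. It transfers to [v], where [g ^+ (e1 * e2)] separates the two sides. *)
have AB : {in A & B, forall a b, a < b}.
  move=> _ _ /mapP[[e1 m1] + ->] /mapP[[e2 m2] + ->].
  rewrite !mem_filter !TP /= => /andP[lt1 /andP[le1 /sP b1]] /andP[lt2 /andP[le2 /sP b2]].
  have /andP[e10 e1N] := le1; have /andP[e20 e2N] := le2.
  rewrite -(ltr_pM2r gL) -(@ltr_pXn2r _ (e1 * e2)%N) ?muln_gt0 ?e10 ?nnegrE ?fg0 //.
  rewrite exprM (fE (e1, m1)) // mulnC exprM (fE (e2, m2)) //= exprAC [ltRHS]exprAC.
  rewrite ltr_pXn2r ?nnegrE ?exprn_ge0 ?ltW ?monom_gt0 //.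
  rewrite ltNge -(similar_monom_le v0 w0 vw b2 b1 e1N e2N) -ltNge.
  apply: (@lt_trans _ _ (g ^+ (e1 * e2))).
    by rewrite exprM ltr_pXn2r // nnegrE ?exprn_ge0 ?ltW ?monom_gt0.
  by rewrite mulnC exprM ltr_pXn2r // nnegrE ?exprn_ge0 ?ltW ?monom_gt0.
have [t [t0 At tB]] := exprn_between_seq ML0 B0 AB.
pose h := g * t ^+ M.
have h0 : 0 < h by rewrite mulr_gt0 ?exprn_gt0.
exists h; split=> //; first by exists t.
have hL : h ^+ L = t ^+ (M * L) * g ^+ L by rewrite exprMn -exprM mulrC.
move=> e m eN /sP ms.
have /andP[e0 _] := eN.
have cT : (e, m) \in T by rewrite TP eN.
have hE : (f (e, m) < t ^+ (M * L)) = (monom w m < h ^+ e) /\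
    (t ^+ (M * L) < f (e, m)) = (h ^+ e < monom w m).
  split; rewrite -(ltr_pM2r gL) -hL -(@ltr_pXn2r _ e) // ?nnegrE ?fg0 ?exprn_ge0 ?ltW //;
  rewrite (fE (e, m)) //= exprAC ltr_pXn2r // nnegrE ?exprn_ge0 ?ltW ?monom_gt0 //.
(* Equality being excluded, [f (e, m)] lies in [A] or in [B], and the choice of [t] gives the same
   strict inequality for [h]. *)
have := noeq _ cT; rewrite /= neq_lt => /orP[] lt.
  have : f (e, m) \in B by apply: map_f; rewrite mem_filter cT lt.
  move/tB; rewrite hE.2 => lt'.
  by rewrite !(ltW lt, ltW lt') !leNgt lt lt'.
have : f (e, m) \in A by apply: map_f; rewrite mem_filter cT lt.
move/At; rewrite hE.1 => lt'.
by rewrite !(ltW lt, ltW lt') !leNgt lt lt'.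
Qed.

Definition update v (i : 'I_k) (g : rat) : 'I_k -> rat := fun j => if j == i then g else v j.

Lemma monom_update v i g m :
  monom (update v i g) m = g ^ m i * monom v [ffun j => if j == i then 0 else m j].
Proof.
rewrite /monom /update (bigD1 i) //= eqxx [in RHS](bigD1 i) //= ffunE eqxx mul1r.
by congr (_ * _); apply: eq_bigr => j /negPf ji; rewrite ffunE ji.
Qed.

(** The sign of [m i] decides on which side of the comparison the power of [g] is isolated. The
    clause on [g = 1], from comparison with the trivial monomial, serves for zeros, whose [mag] is
    1. *)
Lemma similar_update N M v w i (g : rat) : (0 < N)%N -> (0 < M)%N ->
  positive v -> positive w -> similar (2 * N * N) (M * N`!) v w -> 0 < g ->
  exists h : rat, [/\ 0 < h, (g = 1 -> h = 1) & similar N M (update v i g) (update w i h)].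
Proof.
move=> N0 M0 v0 w0 vw g0.
have [h [h0 gh ord]] := similar_extend N0 M0 v0 w0 vw g0.
exists h; split=> //.
  have b0 : bounded N (0 : {ffun 'I_k -> int}) by move=> j; rewrite ffunE.
  have [||+ +] := ord 1%N 0; rewrite ?N0 // !expr1 !monom0 => h1 h2 g1.
  by apply/le_anti; rewrite -h1 -h2 g1 lexx.
split=> [j|m mN]; first rewrite /update.
  case: ifP => // _; apply: congr_pow_dvd (vw.1 j); exact: dvdn_mulr.
rewrite !monom_update; set m' := [ffun j => _].
have bm' : bounded N m' by move=> j; rewrite ffunE; case: ifP.
have bm'N : bounded N (- m') by move=> j; rewrite ffunE abszN.
have := mN i; case: (m i) => [[|e]|e] eN.
- rewrite !mul1r; apply: vw.2 => j; apply: leq_trans (bm' j) _; nia.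
- rewrite -!exprnP -!ler_pdivlMr ?monom_gt0 // !div1r -!monomN //.
  by have [] := ord e.+1 _ eN bm'N.
- rewrite !NegzE -!exprnN mulrC [in RHS]mulrC !ler_pdivrMr ?exprn_gt0 // !mul1r.
  by have [] := ord e.+1 _ eN bm'.
Qed.

End Monomials.

(** * From positive rationals to all rationals: signs and absolute values *)

(* The absolute value, with 0 sent to 1 so that it lands in the group of positive
   rationals; zeros are tracked by Num.sg. *)
Definition mag (x : rat) : rat := if x == 0 then 1 else `|x|.

Lemma mag_gt0 x : 0 < mag x.
Proof. by rewrite /mag; case: eqP => // /eqP; rewrite normr_gt0. Qed.

(** Between two negative numbers the order of the absolute values is reversed, hence the two
    comparisons in the hypothesis. *)
Lemma le_sgr_normr (x y x' y' : rat) : Num.sg x = Num.sg x' -> Num.sg y = Num.sg y' ->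
  (x != 0 -> y != 0 -> (`|x| <= `|y|) = (`|x'| <= `|y'|) /\ (`|y| <= `|x|) = (`|y'| <= `|x'|)) ->
  (x <= y) = (x' <= y').
Proof.
move=> sx sy.
have xp : (0 < x) = (0 < x') by rewrite -sgr_gt0 sx sgr_gt0.
have xn : (x < 0) = (x' < 0) by rewrite -sgr_lt0 sx sgr_lt0.
have yp : (0 < y) = (0 < y') by rewrite -sgr_gt0 sy sgr_gt0.
have yn : (y < 0) = (y' < 0) by rewrite -sgr_lt0 sy sgr_lt0.
case: (ltrgt0P x) xp xn => // hx; case: (ltrgt0P x') => // hx' _ _;
  case: (ltrgt0P y) yp yn => // hy; case: (ltrgt0P y') => // hy' _ _ H;
  by apply/idP/idP; lra.
Qed.

Section Assignments.

Variables k : nat.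
Implicit Types (v w : nat -> rat_mul_le) (t : term) (N M : nat).

Definition magv v : 'I_k -> rat := fun i => mag (v i).

Definition sim N M v w :=
  (forall i : 'I_k, Num.sg (v i : rat) = Num.sg (w i : rat)) /\
  similar N M (magv v) (magv w).

Lemma positive_magv v : positive (magv v).
Proof. by move=> i; apply: mag_gt0. Qed.

Lemma sim_sym N M v w : sim N M v w -> sim N M w v.
Proof. by case=> sg vw; split=> [i|]; [rewrite sg|apply: similar_sym]. Qed.

Lemma sim_weaken N N' M M' v w : (N <= N')%N -> (M %| M')%N ->
  sim N' M' v w -> sim N M v w.
Proof. by move=> NN' MM' [sg vw]; split=> //; apply: similar_weaken vw. Qed.

Lemma sim_update N M v w (i : nat) (a : rat) : (0 < N)%N -> (0 < M)%N -> (i < k)%N ->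
  sim (2 * N * N) (M * N`!) v w ->
  exists b : rat, sim N M [eta v with i |-> a : rat_mul_le] [eta w with i |-> b : rat_mul_le].
Proof.
move=> N0 M0 ik [sg vw].
have [h [h0 h1 vw']] := similar_update (Ordinal ik) N0 M0 (@positive_magv v)
  (@positive_magv w) vw (mag_gt0 a).
(* The partner of [a] is [h] with the sign of [a]. For [a = 0] it is 0, of [mag] 1, and [h] is 1 as
   well. *)
have magE : mag (Num.sg a * h) = h.
  rewrite /mag mulf_eq0 sgr_eq0 (gt_eqF h0) orbF.
  by case: eqP h1 => [->|/eqP a0 _]; [rewrite /mag eqxx => ->|
    rewrite normrM normr_sg a0 mul1r gtr0_norm].
exists (Num.sg a * h); split=> [j|] /=.
  by case: eqP => // _; rewrite sgrM sgr_id (gtr0_sg h0) mulr1.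
have E u c (j : 'I_k) : magv [eta u with i |-> c : rat_mul_le] j
    = update (magv u) (Ordinal ik) (mag c) j.
  by rewrite /magv /update /= -val_eqE /=; case: eqP.
case: vw' => c o; split=> [j|m mN]; first by rewrite !E magE.
by rewrite !(eq_monom _ (E _ _)) magE; apply: o.
Qed.

Definition occ t : {ffun 'I_k -> int} :=
  [ffun i : 'I_k => (count_mem (i : nat) (term_vars t))%:Z].

(** A nonzero product has nonzero factors, and on these [mag] is the absolute value. *)
Lemma normr_eval v t : all (ltn^~ k) (term_vars t) -> eval v t != 0 :> rat ->
  `|eval v t : rat| = monom (magv v) (occ t).
Proof.
elim: t => [i|t1 IH1 t2 IH2] /=.
  rewrite andbT => ik vi; rewrite /monom (bigD1 (Ordinal ik)) //= big1 ?mulr1.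
    by rewrite ffunE /= eqxx /magv /mag (negPf vi).
  by move=> j; rewrite -val_eqE ffunE /= eq_sym => /negPf ->.
rewrite all_cat mulf_eq0 negb_or => /andP[b1 b2] /andP[n1 n2].
rewrite normrM IH1 // IH2 // -monomD; last exact: positive_magv.
by congr monom; apply/ffunP => i; rewrite !ffunE /= count_cat.
Qed.

Lemma sgr_eval N M v w t : sim N M v w -> all (ltn^~ k) (term_vars t) ->
  Num.sg (eval v t : rat) = Num.sg (eval w t : rat).
Proof.
move=> [sg _]; elim: t => [i|t1 IH1 t2 IH2] /=.
  by rewrite andbT => ik; apply: (sg (Ordinal ik)).
by rewrite all_cat !sgrM => /andP[/IH1 -> /IH2 ->].
Qed.

Lemma sim_le N M v w t1 t2 : sim (2 * N * N) M v w ->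
  all (ltn^~ k) (term_vars t1) -> all (ltn^~ k) (term_vars t2) ->
  (size (term_vars t1) <= N)%N -> (size (term_vars t2) <= N)%N -> (0 < N)%N ->
  ((eval v t1 : rat) <= eval v t2) = ((eval w t1 : rat) <= eval w t2).
Proof.
move=> vw b1 b2 s1 s2 N0.
have bnd t : (size (term_vars t) <= N)%N -> bounded N (occ t).
  by move=> st i; rewrite ffunE; apply: leq_trans st; apply: count_size.
have nz t : all (ltn^~ k) (term_vars t) -> eval v t != 0 :> rat -> eval w t != 0 :> rat.
  by move=> bt; rewrite -sgr_eq0 (sgr_eval vw bt) sgr_eq0.
apply: le_sgr_normr; [exact: sgr_eval vw b1|exact: sgr_eval vw b2|].
move=> n1 n2; have [n1' n2'] := (nz _ b1 n1, nz _ b2 n2).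
rewrite (normr_eval b1 n1) (normr_eval b2 n2) (normr_eval b1 n1') (normr_eval b2 n2').
have E := @similar_monom_le _ N M (magv v) (magv w) _ _ 1 1 (@positive_magv v)
  (@positive_magv w) vw.2 _ _ N0 N0.
by have := (E _ _ (bnd _ s1) (bnd _ s2), E _ _ (bnd _ s2) (bnd _ s1)); rewrite !expr1 => -[].
Qed.

End Assignments.

(** * Invariance of every formula under similarity of some level *)

Definition invariant (phi : formula) (k N M : nat) :=
  forall v w : nat -> rat_mul_le, sim k N M v w -> sat v phi <-> sat w phi.

(** [k] counts the tracked variables. Allowing every large [k] lets two subformulas share one [k],
    and lets a quantifier demand that its variable be tracked. *)
Definition eventually_invariant (phi : formula) := exists K, forall k, (K <= k)%N ->
  exists N M, [/\ (0 < N)%N, (0 < M)%N & invariant phi k N M].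

Lemma vars_bound (s : seq nat) : exists K, forall k, (K <= k)%N -> all (ltn^~ k) s.
Proof.
exists (\max_(i <- s) i).+1 => k sk; apply/allP => i /= si.
by apply: leq_trans sk; rewrite ltnS; apply: leq_bigmax_seq.
Qed.

Lemma invariant_atom (t1 t2 : term) :
  eventually_invariant (Eq t1 t2) /\ eventually_invariant (Le t1 t2).
Proof.
have [K1 h1] := vars_bound (term_vars t1); have [K2 h2] := vars_bound (term_vars t2).
pose N := (size (term_vars t1) + size (term_vars t2)).+1.
have le k v w : (maxn K1 K2 <= k)%N -> sim k (2 * N * N) 1 v w ->
    ((eval v t1 : rat) <= eval v t2) = ((eval w t1 : rat) <= eval w t2) /\
    ((eval v t2 : rat) <= eval v t1) = ((eval w t2 : rat) <= eval w t1).
  rewrite geq_max => /andP[/h1 b1 /h2 b2] vw.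
  by split; apply: (sim_le vw) => //; rewrite /N; lia.
split; exists (maxn K1 K2) => k kK; exists (2 * N * N)%N, 1%N; split=> // v w /(le _ _ _ kK) /=;
  last by case=> ->.
(* An equation is a pair of opposite inequalities. *)
move=> [e1 e2]; split=> E; apply/(@le_anti _ rat); rewrite ?e1 ?e2 ?E ?lexx //.
  by rewrite -e1 -e2 E lexx.
Qed.

Lemma invariant_pair (p q : formula) : eventually_invariant p -> eventually_invariant q ->
  exists K, forall k, (K <= k)%N ->
    exists N M, [/\ (0 < N)%N, (0 < M)%N, invariant p k N M & invariant q k N M].
Proof.
move=> [K1 h1] [K2 h2]; exists (maxn K1 K2) => k; rewrite geq_max => /andP[].
move=> /h1[N1 [M1 [N10 M10 i1]]] /h2[N2 [M2 [N20 M20 i2]]].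
(* Similarity weakens to smaller [N] and to divisors of [M], so this level implies both given
   ones. *)
exists (maxn N1 N2), (M1 * M2)%N; split=> [|||].
- by rewrite leq_max N10.
- by rewrite muln_gt0 M10.
- by move=> v w vw; apply: i1; apply: sim_weaken vw; rewrite ?leq_maxl ?dvdn_mulr.
- by move=> v w vw; apply: i2; apply: sim_weaken vw; rewrite ?leq_maxr ?dvdn_mull.
Qed.

(** One quantifier is one round of back-and-forth: [sim_update] supplies the partner value, and the
    symmetry of [sim] gives the converse. *)
Lemma invariant_quantifier (i : nat) (q : formula) : eventually_invariant q ->
  eventually_invariant (Forall i q) /\ eventually_invariant (Exists i q).
Proof.
move=> [K h].
have step k : (maxn K i.+1 <= k)%N -> exists N M, [/\ (0 < N)%N, (0 < M)%N &
    forall v w, sim k N M v w -> forall a : rat_mul_le, exists b : rat_mul_le,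
    sat [eta v with i |-> a] q <-> sat [eta w with i |-> b] q].
  rewrite geq_max => /andP[/h[N [M [N0 M0 inv]]] ik].
  exists (2 * N * N)%N, (M * N`!)%N; rewrite !muln_gt0 N0 M0 fact_gt0; split=> // v w vw a.
  by have [b /inv] := sim_update a N0 M0 ik vw; exists b.
split; exists (maxn K i.+1) => k /step[N [M [N0 M0 st]]]; exists N, M; split=> // v w vw;
  have wv := sim_sym vw; split=> /=.
- by move=> H a; have [b ->] := st _ _ wv a.
- by move=> H a; have [b ->] := st _ _ vw a.
- by move=> [a H]; have [b E] := st _ _ vw a; exists b; apply/E.
- by move=> [a H]; have [b E] := st _ _ wv a; exists b; apply/E.
Qed.

Lemma formula_invariant (phi : formula) : eventually_invariant phi.
Proof.
elim: phi => [|t1 t2|t1 t2|p [K h]|p IHp q IHq|p IHp q IHq|p IHp q IHq|i p IHp|i p IHp].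
- by exists 0%N => k _; exists 1%N, 1%N.
- exact: (invariant_atom t1 t2).1.
- exact: (invariant_atom t1 t2).2.
- exists K => k /h[N [M [N0 M0 inv]]]; exists N, M; split=> // v w /inv /= E.
  by rewrite E.
- have [K h] := invariant_pair IHp IHq; exists K => k /h[N [M [N0 M0 i1 i2]]].
  by exists N, M; split=> // v w vw /=; rewrite (i1 _ _ vw) (i2 _ _ vw).
- have [K h] := invariant_pair IHp IHq; exists K => k /h[N [M [N0 M0 i1 i2]]].
  by exists N, M; split=> // v w vw /=; rewrite (i1 _ _ vw) (i2 _ _ vw).
- have [K h] := invariant_pair IHp IHq; exists K => k /h[N [M [N0 M0 i1 i2]]].
  by exists N, M; split=> // v w vw /=; rewrite (i1 _ _ vw) (i2 _ _ vw).
- exact: (invariant_quantifier i IHp).1.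
- exact: (invariant_quantifier i IHp).2.
Qed.

(** * The indistinguishable values 2 and 2^(M+1) *)

(** The quotient is the M-th power of 2. All other tracked magnitudes are 1, so a monomial is a
    power of 2 or of 2^(M+1), and its comparison with 1 depends only on the sign of the exponent;
    hence any [N] works. *)
Lemma sim_two k N M : sim k N M (assign3 1 1 2) (assign3 1 1 (2 ^+ M.+1)).
Proof.
have e0 : 0 < 2 ^+ M.+1 :> rat by rewrite exprn_gt0.
have mag_id x : 0 < x -> mag x = x.
  by move=> x0; rewrite /mag gt_eqF // gtr0_norm.
have magE c (i : 'I_k) : 0 < c -> magv (assign3 1 1 c) i = if i == 2%N :> nat then c else 1.
  move=> c0; case: i => [[|[|[|i]]] ik]; rewrite /magv /assign3 /=; try exact: mag_id.
  by rewrite nth_nil /mag eqxx.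
split=> [[[|[|[|i]]] ik]|] //=; first by rewrite /assign3 /= !gtr0_sg.
split=> [i|m _].
  rewrite !magE //; case: eqP => _; last exact: congr_pow_refl.
  by exists 2; rewrite // exprS.
(* If [k <= 2], the variable 2 is not tracked and all monomials equal 1. *)
have [k2|k2] := ltnP 2 k; last first.
  rewrite /monom !big1 // => i _; rewrite magE // ifN ?exp1rz //;
    by apply: contraTneq (ltn_ord i) => ->; rewrite -leqNgt.
have E c : 0 < c -> monom (magv (assign3 1 1 c)) m = c ^ m (Ordinal k2).
  move=> c0; rewrite (@monom_single _ _ _ (Ordinal k2)) ?magE //= => j.
  by rewrite -val_eqE magE //= => /negPf ->.
rewrite !E //; case: (m _) => e.
  by rewrite -!exprnP -exprM -[1](expr0 2) !ler_eXn2l // !leqn0 muln_eq0.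
by rewrite !NegzE -!exprnN !invf_le1 ?exprn_gt0 // -exprM !exprn_ege1.
Qed.

Theorem mainTheorem5 :
  ~ exists phi : formula,
      {subset free_vars phi <= [:: 0; 1; 2]%N} /\
      forall x y z : rat, x + y = z <-> sat (assign3 x y z) phi.
Proof.
move=> [phi [_ def]].
have [K h] := formula_invariant phi.
have [N [M [_ M0 inv]]] := h K (leqnn K).
(* Invariance carries [1 + 1 = 2] over to [1 + 1 = 2 ^+ M.+1], which is false since [M] is
   positive. *)
have /def : sat (assign3 1 1 (2 ^+ M.+1)) phi.
  by apply/(inv _ _ (sim_two K N M)); apply/def.
move=> E.
have := @ltr_eXn2l rat 2 isT 1 M.+1; rewrite -E expr1 ltxx ltnS M0.
by [].
Qed.
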